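(* Let $p$ be an odd prime and $n\ge 1$. For every $i\ge 1$, $$\gamma_i(W_n)=(\gamma_i(W_n)\cap B_n)\rtimes\cdots\rtimes(\gamma_i(W_n)\cap B_1).$$
   Context: Let $p$ be an odd prime and $n\ge 1$ an integer. For $1\le k\le n$ let $B_k=\mathrm{Fun}(\mathbb{F}_p^{k-1},\mathbb{F}_p)$ (additive group; $B_1=\mathbb{F}_p$). Write $f\Delta_k$ for $f$ regarded as an element of $B_k$. The element $f\Delta_k$ acts on $\mathbb{F}_p^n$ as the permutation $x\mapsto x-f(x_1,\dots,x_{k-1})e_k$. $W_n$ is the subgroup of $\mathrm{Sym}(\mathbb{F}_p^n)$ generated by $B_1,\dots,B_n$ (the $n$-fold iterated wreath product of $\mathbb{F}_p$, a Sylow $p$-subgroup of $\mathrm{Sym}(p^n)$); one has $W_n=B_n\rtimes\cdots\rtimes B_1$, where for each $k$ the product $B_nB_{n-1}\cdots B_{k+1}$ is normal in $W_n$. The claimed iterated semidirect product is internal and taken in the same sense: for each $k<n$ the subgroup $(\gamma_i(W_n)\cap B_n)\cdots(\gamma_i(W_n)\cap B_{k+1})$ is normalized by, and meets trivially, $\gamma_i(W_n)\cap B_k$, and the product of all factors is $\gamma_i(W_n)$. $\gamma_1(W_n)=W_n$, $\gamma_{i+1}(W_n)=[\gamma_i(W_n),W_n]$. *)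

(* Defs.v *)
From HB Require Import structures.
From mathcomp Require Import all_boot all_order all_algebra all_fingroup all_solvable.

Set Implicit Arguments.
Unset Strict Implicit.
Unset Printing Implicit Defensive.

Import GRing.Theory.

(* Indices are 0-based: k : 'I_n stands for the level k + 1 in {1, ..., n}. *)

Section IteratedWreath.

Variables (p n : nat).

Local Open Scope ring_scope.

Definition prefix (k : 'I_n) (x : 'rV['F_p]_n) : 'rV['F_p]_k :=
  \row_(j < k) x 0 (widen_ord (ltnW (ltn_ord k)) j).

Definition Delta_fun (k : 'I_n) (f : {ffun 'rV['F_p]_k -> 'F_p})
    (x : 'rV['F_p]_n) : 'rV['F_p]_n :=
  x - f (prefix k x) *: delta_mx 0 k.

Lemma prefix_Delta (k : 'I_n) (f : {ffun 'rV['F_p]_k -> 'F_p}) x :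
  prefix k (Delta_fun f x) = prefix k x.
Proof.
apply/rowP=> j; rewrite !mxE eqxx /=.
have /negPf-> : widen_ord (ltnW (ltn_ord k)) j != k.
  by rewrite -val_eqE /= neq_ltn ltn_ord.
by rewrite mulr0 subr0.
Qed.

Lemma Delta_inj (k : 'I_n) (f : {ffun 'rV['F_p]_k -> 'F_p}) :
  injective (Delta_fun f).
Proof.
move=> x y exy; have := prefix_Delta f x; rewrite exy prefix_Delta => epq.
by move: exy; rewrite /Delta_fun epq => /addIr.
Qed.

Definition Delta (k : 'I_n) (f : {ffun 'rV['F_p]_k -> 'F_p}) :
  {perm 'rV['F_p]_n} := perm (@Delta_inj k f).

Lemma DeltaE (k : 'I_n) (f : {ffun 'rV['F_p]_k -> 'F_p}) x :
  Delta f x = x - f (prefix k x) *: delta_mx 0 k.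
Proof. by rewrite permE. Qed.

Lemma DeltaD (k : 'I_n) (f g : {ffun 'rV['F_p]_k -> 'F_p}) :
  Delta (f + g) = (Delta f * Delta g)%g.
Proof.
apply/permP=> x; rewrite permM !permE {2}/Delta_fun prefix_Delta /Delta_fun.
by rewrite ffunE scalerDl opprD addrA.
Qed.

Lemma Delta0 (k : 'I_n) : Delta (0 : {ffun 'rV['F_p]_k -> 'F_p}) = 1%g.
Proof. by apply/permP=> x; rewrite DeltaE ffunE scale0r subr0 perm1. Qed.

Definition B (k : 'I_n) : {set {perm 'rV['F_p]_n}} :=
  [set Delta f | f : {ffun 'rV['F_p]_k -> 'F_p}].

Lemma B_group_set (k : 'I_n) : group_set (B k).
Proof.
apply/group_setP; split=> [|_ _ /imsetP[f _ ->] /imsetP[g _ ->]].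
  by rewrite -(Delta0 k); apply: imset_f.
by rewrite -DeltaD; apply: imset_f.
Qed.

Canonical B_group (k : 'I_n) := Group (B_group_set k).

Local Open Scope group_scope.

Definition W : {group {perm 'rV['F_p]_n}} := <<\bigcup_(k < n) B k>>%G.

End IteratedWreath.

Arguments B p {n} k.

Section IteratedSdprod.

Local Open Scope group_scope.

(* ((A_1 ><| A_2) ><| A_3) ><| ... for s = [:: A_1; A_2; A_3; ...]; the normal *)
(* factor is on the left.  For groups A and H, A ><| H is the empty set, which *)
(* then propagates, unless H normalises A and A :&: H = 1; so an equation     *)
(* iter_sdprod s = G includes these conditions at every step.                 *)
Definition iter_sdprod (gT : finGroupType) (s : seq {set gT}) : {set gT} :=
  foldl (fun A H => A ><| H) 1 s.

End IteratedSdprod.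

(* Main.v *)
Require Import Defs.
From mathcomp Require Import all_boot all_order all_algebra all_fingroup all_solvable.

Set Implicit Arguments.
Unset Strict Implicit.
Unset Printing Implicit Defensive.

Import GRing.Theory.

Local Open Scope group_scope.

(** The decomposition is a property of semidirect products in general.  If
    G = N ><| H, then the projection of G onto H along N maps 'L_i(G) into
    'L_i(H), which is again inside 'L_i(G); hence both factors of an element of
    'L_i(G) lie in 'L_i(G), and 'L_i(G) splits along N ><| H
    ([lcn_sdprod_subset]).

    In W this applies to every cut of the levels.  Let [upper k] be generated by
    the B j with k <= j and [lower k] by those with j < k.  A generator at level
    j normalises B l as soon as j <= l, because conjugation only precomposes the
    function of the first l coordinates with a bijection of these coordinates
    ([B_norm]), while B j lies in [upper k] as soon as k <= j; so [upper k] is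
    normal in W.  It fixes the first k coordinates and [lower k] fixes the
    others, so the two meet trivially and W = upper k ><| lower k
    ([W_sdprod]).  Since B k lies in [lower k.+1], splitting 'L_i(W) :&: upper k
    along upper k = upper k.+1 * B k gives
    'L_i(W) :&: upper k = ('L_i(W) :&: upper k.+1) ><| ('L_i(W) :&: B k),
    and these equations chain from k = n down to k = 0. *)

(** * Lower central series of a semidirect product *)

(** Modulo N the groups G and H coincide, hence so do their lower central
    series. *)
Lemma lcn_sdprod_subset (gT : finGroupType) (N H G : {group gT}) i :
  N ><| H = G -> 'L_i(G) \subset N * 'L_i(H).
Proof.
case/sdprodP=> _ defG nNH _.
have nNG : G \subset 'N(N) by rewrite -defG mul_subG ?normG.
have nNL := subset_trans (lcn_sub i _) nNG.
rewrite -quotientSK // /quotient !morphim_lcn //.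
by rewrite -/(quotient _ _) -defG quotientMidl.
Qed.

(** By uniqueness of the decomposition along N and H, the right factor of an
    element of N * 'L_i(H) is in 'L_i(H). *)
Lemma lcn_sdprod_right (gT : finGroupType) (N H G : {group gT}) i x h :
  N ><| H = G -> x \in N -> h \in H -> x * h \in 'L_i(G) -> h \in 'L_i(G).
Proof.
move=> defG Nx Hh /(subsetP (lcn_sdprod_subset i defG)) /mulsgP[y g Ny Lg eq_xh].
have Hg := subsetP (lcn_sub i _) _ Lg.
have [_ eqG _ tiNH] := sdprodP defG.
have sHG : H \subset G by rewrite -eqG mulG_subr.
suff -> : h = g by apply: (subsetP (lcnS i sHG)).
have eq_hg : h * g^-1 = x^-1 * y.
  by apply: (canLR (mulgK g)); rewrite -mulgA -eq_xh mulKg.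
have : h * g^-1 \in N :&: H.
  by rewrite inE {1}eq_hg !groupM ?groupV.
by rewrite tiNH => /set1P/eqP; rewrite -eq_mulgV1 => /eqP.
Qed.

(** The form used to peel one level off: K is only a part of the complement H,
    so that N * K need not be all of G. *)
Lemma lcn_sdprod_cut (gT : finGroupType) (N H G K : {group gT}) i :
  N ><| H = G -> K \subset H ->
  ('L_i(G) :&: N) ><| ('L_i(G) :&: K) = 'L_i(G) :&: (N * K).
Proof.
move=> defG sKH; have [_ eqG nNH tiNH] := sdprodP defG.
have sHG : H \subset G by rewrite -eqG mulG_subr.
have sKG := subset_trans sKH sHG.
rewrite sdprodE; last first.
- by apply/trivgP; rewrite -tiNH setISS ?subsetIr // (subset_trans _ sKH) ?subsetIr.
- apply: subset_trans (subsetIr _ _) _; apply: normsI.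
    exact: subset_trans sKG (normal_norm (lcn_normal _ _)).
  exact: subset_trans sKH nNH.
apply/eqP; rewrite eqEsubset; apply/andP; split.
  rewrite subsetI mulgSS ?subsetIr // andbT.
  by rewrite mul_subG ?subsetIl.
apply/subsetP=> y; rewrite inE andbC => /andP[/mulsgP[x k Nx Kk ->] L_xk].
have Lk := lcn_sdprod_right defG Nx (subsetP sKH k Kk) L_xk.
apply: mem_mulg; rewrite inE ?Lk ?Kk // Nx andbT.
by rewrite -(groupMr _ Lk).
Qed.

(** * Action of the levels on coordinates *)

Section Levels.

Variables p n : nat.

Local Notation prefix := Defs.prefix.

Implicit Types (j k l : 'I_n) (x y : 'rV['F_p]_n).

Lemma prefixP k x y :
  (forall j, (j < k)%N -> x 0%R j = y 0%R j) <-> prefix k x = prefix k y.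
Proof.
split=> [eq_xy | /rowP eq_xy j lt_jk].
  by apply/rowP=> j; rewrite !mxE; apply: eq_xy => /=.
have := eq_xy (Ordinal lt_jk); rewrite !mxE.
by rewrite (_ : widen_ord _ _ = j) //; apply: val_inj.
Qed.

Lemma Delta_coord k (f : {ffun 'rV['F_p]_k -> 'F_p}) x j :
  j != k -> Delta f x 0%R j = x 0%R j.
Proof.
by move=> /negPf ne_jk; rewrite DeltaE !mxE eqxx ne_jk mulr0 subr0.
Qed.

Lemma Delta_coord_diag k (f : {ffun 'rV['F_p]_k -> 'F_p}) x :
  Delta f x 0%R k = (x 0%R k - f (prefix k x))%R.
Proof. by rewrite DeltaE !mxE !eqxx mulr1. Qed.

Lemma DeltaV k (f : {ffun 'rV['F_p]_k -> 'F_p}) : (Delta f)^-1 = Delta (- f)%R.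
Proof.
by apply/eqP; rewrite eq_sym eq_mulgV1 invgK -DeltaD addNr Delta0.
Qed.

(** Whether k < l or not, the first l coordinates of the image under level k
    are determined by the first l coordinates of the argument. *)
Lemma prefix_Delta_eq l k (f : {ffun 'rV['F_p]_k -> 'F_p}) x y :
  prefix l x = prefix l y -> prefix l (Delta f x) = prefix l (Delta f y).
Proof.
move=> /prefixP eq_xy; apply/prefixP=> j lt_jl.
have [eq_jk | ne_jk] := eqVneq j k; last by rewrite !Delta_coord ?eq_xy.
rewrite {j}eq_jk in lt_jl *; rewrite !Delta_coord_diag eq_xy //.
suff -> : prefix k x = prefix k y by [].
by apply/prefixP=> j lt_jk; apply: eq_xy; apply: ltn_trans lt_jk lt_jl.
Qed.

(** Conjugating by level k precomposes f with the permutation of the first l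
    coordinates induced by level k.  Since k <= l, the move at level l leaves
    the argument of the function at level k alone, so the two moves at level k
    cancel. *)
Lemma B_norm k l : (k <= l)%N -> B p k \subset 'N(B p l).
Proof.
move=> le_kl; apply/subsetP=> g /imsetP[h _ ->]; rewrite inE.
apply/subsetP=> _ /imsetP[_ /imsetP[f _ ->] ->].
(* A representative in the whole space of a vector of first coordinates. *)
pose ext (v : 'rV['F_p]_l) : 'rV['F_p]_n :=
  (\row_j if insub (val j) is Some i then v 0 i else 0)%R.
have prefix_ext v : prefix l (ext v) = v.
  apply/rowP=> j; rewrite !mxE /= insubT //= => lt_jl.
  by congr (v _ _); apply: val_inj.
apply/imsetP; exists [ffun v => f (prefix l (Delta (- h)%R (ext v)))] => //.
apply/permP=> x; rewrite conjgE DeltaV !permM.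
set y := Delta (- h)%R x.
have def_x : x = Delta h y by rewrite /y -permM -DeltaD addNr Delta0 perm1.
have eq_y : prefix l (Delta (- h)%R (ext (prefix l x))) = prefix l y.
  by apply: prefix_Delta_eq; rewrite prefix_ext.
rewrite [RHS]DeltaE ffunE eq_y {1}def_x.
have eq_yk : prefix k (Delta f y) = prefix k y.
  apply/prefixP=> j lt_jk; apply: Delta_coord.
  by rewrite -val_eqE neq_ltn (leq_trans lt_jk).
by rewrite [LHS]DeltaE eq_yk !DeltaE addrAC.
Qed.

(** * The cut of W between two levels *)

Definition upper (m : nat) : {group {perm 'rV['F_p]_n}} :=
  <<\bigcup_(k < n | (m <= k)%N) B p k>>%G.

Definition lower (m : nat) : {group {perm 'rV['F_p]_n}} :=
  <<\bigcup_(k < n | (k < m)%N) B p k>>%G.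

Lemma B_sub_upper m k : (m <= k)%N -> B p k \subset upper m.
Proof. by move=> le_mk; rewrite sub_gen // bigcup_sup. Qed.

Lemma B_sub_lower m k : (k < m)%N -> B p k \subset lower m.
Proof. by move=> lt_km; rewrite sub_gen // bigcup_sup. Qed.

(** For m <= k the level lies in [upper m]; for k < m it normalises each
    generating level separately. *)
Lemma B_norm_upper m k : B p k \subset 'N(upper m).
Proof.
have [le_mk | lt_km] := leqP m k.
  exact: subset_trans (B_sub_upper le_mk) (normG _).
rewrite norms_gen // norms_bigcup //; apply/bigcapsP=> l le_ml.
exact/B_norm/ltnW/(leq_trans lt_km).
Qed.

Lemma lower_norm_upper m : lower m \subset 'N(upper m).
Proof. by rewrite gen_subG; apply/bigcupsP=> k _; apply: B_norm_upper. Qed.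

(** Moving no coordinate in a given set of indices is a group condition, so it
    passes from the generators to the group that they generate. *)
Lemma gen_coord_fix (P Q : pred 'I_n) g x j :
    (forall k, P k -> ~~ Q k) -> g \in <<\bigcup_(k < n | P k) B p k>> -> Q j ->
  g x 0%R j = x 0%R j.
Proof.
move=> disPQ /gen_prodgP[m [c Bc ->]] Qj.
elim/big_rec: _ x => [|i h _ IHh] x; first by rewrite perm1.
rewrite permM IHh; have /bigcupP[k Pk /imsetP[f _ ->]] := Bc i.
by apply: Delta_coord; apply: contraTneq Qj => ->; apply: disPQ.
Qed.

Lemma upper_lower_trivg m : upper m :&: lower m = 1.
Proof.
apply/trivgP/subsetP=> g /setIP[Ug Lg]; apply/set1P/permP=> x; rewrite perm1.
apply/rowP=> j; have [lt_jm | le_mj] := ltnP j m.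
  apply: (gen_coord_fix (Q := fun k => (k < m)%N) _ _ Ug lt_jm) => k.
  by rewrite -leqNgt.
apply: (gen_coord_fix (Q := fun k => (m <= k)%N) _ _ Lg le_mj) => k.
by rewrite -ltnNge.
Qed.

Lemma W_sdprod m : upper m ><| lower m = W p n.
Proof.
rewrite sdprodE ?lower_norm_upper ?upper_lower_trivg //.
rewrite -norm_joinEr ?lower_norm_upper // joing_idl joing_idr.
rewrite [RHS]/= [in RHS](bigID (fun k : 'I_n => (m <= k)%N)) /=.
congr (generated (_ :|: _)).
by apply: eq_bigl => k; rewrite -ltnNge.
Qed.

Lemma upper_mul k : upper k.+1 * B p k = upper k.
Proof.
rewrite -[B p k]/(gval (B_group p k)) -norm_joinEr ?B_norm_upper // joing_idl.
rewrite [RHS]/= [in RHS](bigD1 k) //= setUC; congr (generated (_ :|: _)).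
by apply: eq_bigl => l; rewrite ltn_neqAle andbC eq_sym.
Qed.

Lemma upper_max : upper n = 1 :> {set _}.
Proof.
by rewrite /= big_pred0 ?gen0 // => k; rewrite leqNgt ltn_ord.
Qed.

Lemma upper0 : upper 0 = W p n :> {set _}.
Proof. by []. Qed.

(** Level k splits off on the right because it lies in the complement
    [lower k.+1] of [upper k.+1]. *)
Lemma lcn_upper_step i k :
  ('L_i(W p n) :&: upper k.+1) ><| ('L_i(W p n) :&: B p k)
    = 'L_i(W p n) :&: upper k.
Proof.
rewrite -(upper_mul k).
exact: (lcn_sdprod_cut (K := B_group p k) i (W_sdprod k.+1) (B_sub_lower (ltnSn k))).
Qed.

(** The [foldl] over the reversed list is a [foldr] over the increasing list of
    levels, so the levels are adjoined one at a time by induction on n - m,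
    starting from the trivial group at m = n. *)
Lemma lcn_upper_iter i m : (m <= n)%N ->
  iter_sdprod [seq 'L_i(W p n) :&: B p k | k <- rev (drop m (enum 'I_n))]
    = 'L_i(W p n) :&: upper m.
Proof.
rewrite /iter_sdprod map_rev foldl_rev => le_mn.
move: (n - m)%N (subnKC le_mn) => d; elim: d m {le_mn} => [|d IHd] m.
  rewrite addn0 => ->.
  by rewrite drop_oversize ?size_enum_ord // upper_max (setIidPr (sub1G _)).
rewrite addnS => def_n; have lt_mn : (m < n)%N by rewrite -def_n ltnS leq_addr.
rewrite (drop_nth (Ordinal lt_mn)) ?size_enum_ord //=.
rewrite IHd ?addSn // (_ : nth _ _ m = Ordinal lt_mn).
  exact: lcn_upper_step i (Ordinal lt_mn).
by apply: val_inj; exact: nth_enum_ord.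
Qed.

End Levels.

Theorem corollary3p6 (p n i : nat) (p_prime : prime p) (p_odd : odd p)
    (n_ge1 : (1 <= n)%N) (i_ge1 : (1 <= i)%N) :
  iter_sdprod [seq 'L_i(W p n) :&: B p k | k <- rev (enum 'I_n)] = 'L_i(W p n).
Proof.
have := lcn_upper_iter p i (leq0n n); rewrite drop0 upper0 => ->.
by apply/setIidPl/lcn_sub.
Qed.
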